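(* Let $(\Xi,\Xi^\infty)$ and $(\Lambda,\Lambda^\infty)$ be countable approximate groups, and let $f:\Xi^\infty\to\Lambda^\infty$ be a function with $f(\Xi)\subseteq\Lambda$ which is a quasimorphism (i.e. its defect set $D(f)=\{f(y)^{-1}f(x)^{-1}f(xy)\mid x,y\in\Xi^\infty\}$ is finite), which is symmetric ($f(x^{-1})=f(x)^{-1}$ for all $x\in\Xi^\infty$) and unital ($f(e_{\Xi^\infty})=e_{\Lambda^\infty}$). Then \[\operatorname{asdim}\Xi\leq \operatorname{asdim}\Lambda+\operatorname{asdim}\big(f^{-1}(D(f))\big),\] where $f^{-1}(D(f))\subseteq\Xi^\infty$.
   Context: A subset $\Lambda$ of a group $G$ is an approximate subgroup if $\Lambda=\Lambda^{-1}$, $e\in\Lambda$, and there is a finite $F\subset G$ with $\Lambda^2=\Lambda\Lambda\subseteq\Lambda F$. Its enveloping group is $\Lambda^\infty=\bigcup_{k\in\mathbb N}\Lambda^k$, the subgroup generated by $\Lambda$; the pair $(\Lambda,\Lambda^\infty)$ is called an approximate group, and it is countable if $\Lambda$ is countable. Asymptotic dimension of a metric space $X$: the least $n\in\mathbb N_0$ such that for every $R>0$ there is a cover of $X$ by sets of uniformly bounded diameter which splits into $n+1$ families, each $R$-disjoint (distinct members at distance $\geq R$); $\infty$ if no such $n$. For a countable approximate group $(\Lambda,\Lambda^\infty)$ and any subset $A\subseteq\Lambda^\infty$, $\operatorname{asdim}A$ means the asymptotic dimension of $(A,d|_{A\times A})$, where $d$ is any left-invariant proper metric on the countable discrete group $\Lambda^\infty$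 (this is independent of the choice of $d$); in particular $\operatorname{asdim}\Lambda$ is defined this way. *)

(* Defs.v *)
From Stdlib Require Import Reals List.
Open Scope R_scope.

Record Group := {
  carrier :> Type;
  gmul : carrier -> carrier -> carrier;
  ginv : carrier -> carrier;
  gone : carrier;
  gmul_assoc : forall x y z, gmul x (gmul y z) = gmul (gmul x y) z;
  gmul_1l : forall x, gmul gone x = x;
  gmul_1r : forall x, gmul x gone = x;
  gmul_Vl : forall x, gmul (ginv x) x = gone;
  gmul_Vr : forall x, gmul x (ginv x) = gone
}.

Arguments gmul {g}.
Arguments ginv {g}.
Arguments gone {g}.

Inductive generated {G : Group} (L : G -> Prop) : G -> Prop :=
| gen_one : generated L gone
| gen_in : forall x, L x -> generated L x
| gen_inv : forall x, generated L x -> generated L (ginv x)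
| gen_mul : forall x y, generated L x -> generated L y -> generated L (gmul x y).

Definition approx_subgroup {G : Group} (L : G -> Prop) : Prop :=
  (forall x, L x -> L (ginv x)) /\ L gone /\
  exists F : list G, forall x y, L x -> L y ->
    exists l z, L l /\ In z F /\ gmul x y = gmul l z.

Definition approx_group (G : Group) (L : G -> Prop) : Prop :=
  approx_subgroup L /\ forall x : G, generated L x.

Definition countable_set {T : Type} (A : T -> Prop) : Prop :=
  exists c : T -> nat, forall x y, A x -> A y -> c x = c y -> x = y.

Definition proper_left_invariant_metric (G : Group) (d : G -> G -> R) : Prop :=
  (forall x y, 0 <= d x y) /\
  (forall x y, d x y = 0 <-> x = y) /\
  (forall x y, d x y = d y x) /\
  (forall x y z, d x z <= d x y + d y z) /\
  (forall g x y, d (gmul g x) (gmul g y) = d x y) /\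
  (* properness: closed balls are finite (= compact in the discrete group) *)
  (forall r, exists l : list G, forall y, d gone y <= r -> In y l).

Definition asdim_le_metric {T : Type} (d : T -> T -> R) (A : T -> Prop) (n : nat)
  : Prop :=
  forall Rr : R, 0 < Rr ->
    exists (I : Type) (U : I -> T -> Prop) (col : I -> nat),
      (forall i, (col i <= n)%nat) /\
      (forall i x, U i x -> A x) /\
      (forall x, A x -> exists i, U i x) /\
      (exists S : R, forall i x y, U i x -> U i y -> d x y <= S) /\
      (forall i j, i <> j -> col i = col j ->
         forall x y, U i x -> U j y -> Rr <= d x y).

(** asdim A <= n for A a subset of a countable group, computed w.r.t. a
    (any, equivalently every) left-invariant proper metric. *)
Definition asdim_le (G : Group) (A : G -> Prop) (n : nat) : Prop :=
  forall d, proper_left_invariant_metric G d -> asdim_le_metric d A n.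

Definition defect {G H : Group} (f : G -> H) (z : H) : Prop :=
  exists x y : G, z = gmul (ginv (f y)) (gmul (ginv (f x)) (f (gmul x y))).

Definition quasimorphism {G H : Group} (f : G -> H) : Prop :=
  exists l : list H, forall z, defect f z -> In z l.

Definition symmetric_map {G H : Group} (f : G -> H) : Prop :=
  forall x, f (ginv x) = ginv (f x).

Definition unital_map {G H : Group} (f : G -> H) : Prop := f gone = gone.

(* Main.v *)
(** A set is decomposed at scale [r] by colour classes whose [r]-components are
    uniformly bounded.  Kolmogorov's trick turns [n + 1] colour classes covering
    a set of asymptotic dimension at most [n] into [k > n] classes such that
    every point lies in all but at most [n] of them.

    By the quasimorphism property, preimages under [f] of sets of bounded
    diameter are, up to a left translation and a bounded error, contained in
    [f^-1(D(f))]; hence they have asymptotic dimension at most [m], uniformly.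

    Let [k = n + m + 1].  Choose [k] classes [Y_i] on [Lam] with components of
    diameter at most [R], every point missing at most [n] of them, and then
    [n + 1] families of sets [T_j] covering [Lam], each family being
    [(R + 1)]-disjoint.  Decompose [f^-1(T_j)] into [k] classes, every point
    missing at most [m] of them, at a scale which grows with the family of
    [T_j], and let [E_i] be the union of the [i]-th classes.  A set of diameter
    at most [R] meets at most one [T_j] of each family, so over such a set the
    components of [E_i] are bounded by the finite union theorem.  Hence the
    components of the intersection of [E_i] and [f^-1(Y_i)] are bounded, and
    these [k] sets cover since a point misses at most [n + m] of them. *)

Require Import Defs.
From Stdlib Require Import Reals List Lra Lia Classical IndefiniteDescription.
From Stdlib Require Import FunctionalExtensionality PropExtensionality.

(** * Groups and proper metrics *)

Lemma gmul_invl_cancel (G : Group) (x y : G) : gmul (ginv x) (gmul x y) = y.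
Proof. now rewrite gmul_assoc, gmul_Vl, gmul_1l. Qed.

Lemma gmul_invr_cancel (G : Group) (x y : G) : gmul x (gmul (ginv x) y) = y.
Proof. now rewrite gmul_assoc, gmul_Vr, gmul_1l. Qed.

Lemma ginv_unique (G : Group) (x y : G) : gmul x y = gone -> ginv x = y.
Proof.
intros h. now rewrite <- (gmul_invl_cancel G x y), h, gmul_1r.
Qed.

Lemma ginv_involutive (G : Group) (x : G) : ginv (ginv x) = x.
Proof. apply ginv_unique, gmul_Vl. Qed.

Lemma ginv_gone (G : Group) : ginv gone = gone :> G.
Proof. apply ginv_unique, gmul_1l. Qed.

Lemma ginv_gmul (G : Group) (x y : G) :
  ginv (gmul x y) = gmul (ginv y) (ginv x).
Proof.
apply ginv_unique.
now rewrite <- gmul_assoc, gmul_invr_cancel, gmul_Vr.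
Qed.

(** The successor makes every letter cost at least one, so only the identity has a word of length
    zero, and balls are finite by induction on the length. *)
Inductive word {G : Group} (L : G -> Prop) (w : G -> nat) : nat -> G -> Prop :=
| word_one : word L w 0 gone
| word_snoc n x a : word L w n x -> L a -> word L w (n + S (w a)) (gmul x a).

Lemma word_gmul (G : Group) (L : G -> Prop) w n m (x y : G) :
  word L w n x -> word L w m y -> word L w (n + m) (gmul x y).
Proof.
intros hx hy; induction hy as [|m y a hy IH ha].
- now rewrite gmul_1r, Nat.add_0_r.
- rewrite gmul_assoc, Nat.add_assoc. now constructor.
Qed.

Lemma word_ginv (G : Group) (L : G -> Prop) w n (x : G) :
  (forall a, L a -> L (ginv a)) -> (forall a, w (ginv a) = w a) ->
  word L w n x -> word L w n (ginv x).
Proof.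
intros hL hw hx; induction hx as [|n x a hx IH ha].
- rewrite ginv_gone; constructor.
- rewrite ginv_gmul, Nat.add_comm. apply word_gmul; [|exact IH].
  rewrite <- (gmul_1l G (ginv a)), <- (hw a).
  now apply (word_snoc L w 0); [constructor|apply hL].
Qed.

Lemma word_generated (G : Group) (L : G -> Prop) w (x : G) :
  (forall a, L a -> L (ginv a)) -> (forall a, w (ginv a) = w a) ->
  generated L x -> exists n, word L w n x.
Proof.
intros hL hw hx; induction hx as [|x hx|x _ [n IH]|x y _ [n IHx] _ [p IHy]].
- exists 0%nat; constructor.
- exists (0 + S (w x))%nat. rewrite <- (gmul_1l G x) at 2.
  now constructor; [constructor|].
- exists n. now apply word_ginv.
- exists (n + p)%nat. now apply word_gmul.
Qed.

Lemma word0 (G : Group) (L : G -> Prop) w (x : G) : word L w 0 x -> x = gone.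
Proof. intros h; inversion h; [reflexivity|lia]. Qed.

Lemma countable_set_sublevel_finite (T : Type) (L : T -> Prop) (c : T -> nat) :
  (forall x y, L x -> L y -> c x = c y -> x = y) ->
  forall n, exists l, forall x, L x -> (c x < n)%nat -> In x l.
Proof.
intros hc n; induction n as [|n [l hl]].
- exists nil; intros; lia.
- destruct (classic (exists a, L a /\ c a = n)) as [[a [ha <-]]|hn].
  + exists (a :: l). intros x hx hxn.
    destruct (Nat.eq_dec (c x) (c a)) as [e|e].
    * left. now apply hc.
    * right. apply hl; [assumption|lia].
  + exists l. intros x hx hxn. apply hl; [assumption|].
    destruct (Nat.eq_dec (c x) n) as [e|e]; [|lia].
    exfalso; apply hn; now exists x.
Qed.

Lemma word_ball_finite (G : Group) (L : G -> Prop) w :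
  (forall n, exists l, forall x, L x -> (w x < n)%nat -> In x l) ->
  forall n, exists l, forall p x, (p <= n)%nat -> word L w p x -> In x l.
Proof.
intros hw n; induction n as [|n [l hl]].
- exists (gone :: nil). intros p x hp h.
  replace p with 0%nat in h by lia. left. symmetry; now apply word0 with L w.
- destruct (hw (S n)) as [l' hl'].
  exists (gone :: map (fun q => gmul (fst q) (snd q)) (list_prod l l')).
  intros p x hp h. destruct h as [|p x a h ha]; [now left|right].
  apply (in_map (fun q : G * G => gmul (fst q) (snd q)) _ (x, a)).
  apply in_prod; [apply (hl p)|apply hl']; trivial; lia.
Qed.

(* Words in [L] are weighted so that only finitely many letters have a given
   weight; this makes the balls of the word metric finite although [L] need not
   be. *)
Lemma proper_left_invariant_metric_exists (G : Group) (L : G -> Prop) :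
  (forall a, L a -> L (ginv a)) -> countable_set L ->
  (forall x, generated L x) -> exists d, proper_left_invariant_metric G d.
Proof.
intros hL [c hc] hgen.
(* Symmetrised so that inverting a word keeps its weight; [w a < n] still forces [c a < n], which
   leaves finitely many letters. *)
set (w := fun a : G => (c a + c (ginv a))%nat).
assert (hw : forall a, w (ginv a) = w a).
{ intros a; unfold w; rewrite ginv_involutive; lia. }
destruct (functional_choice
  (fun x n => word L w n x /\ forall p, word L w p x -> (n <= p)%nat))
  as [len hlen].
{ intros x. destruct (word_generated G L w x hL hw (hgen x)) as [n hn].
  revert hn. induction n as [n IH] using (well_founded_induction Nat.lt_wf_0).
  intros hn.
  destruct (classic (exists p, word L w p x /\ (p < n)%nat))
    as [[p [hp hpn]]|hmin].
  - exact (IH p hpn hp).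
  - exists n; split; [exact hn|]. intros p hp.
    destruct (Nat.le_gt_cases n p); [assumption|].
    exfalso; apply hmin; now exists p. }
assert (len1 : len gone = 0%nat).
{ enough (len gone <= 0)%nat by lia. apply hlen. constructor. }
assert (lenV : forall x, (len (ginv x) <= len x)%nat).
{ intros x; apply hlen. apply word_ginv; trivial. apply hlen. }
assert (lenM : forall x y, (len (gmul x y) <= len x + len y)%nat).
{ intros x y; apply hlen. apply word_gmul; apply hlen. }
exists (fun x y => INR (len (gmul (ginv x) y))).
repeat split.
- intros; apply pos_INR.
- intros h. apply (INR_eq _ 0) in h.
  pose proof (proj1 (hlen (gmul (ginv x) y))) as hxy; rewrite h in hxy.
  apply word0 in hxy.
  now rewrite <- (gmul_invr_cancel G x y), hxy, gmul_1r.
- intros <-. now rewrite gmul_Vl, len1.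
- assert (le : forall x y,
      (len (gmul (ginv x) y) <= len (gmul (ginv y) x))%nat).
  { intros x y. rewrite <- (ginv_involutive G x) at 2.
    rewrite <- ginv_gmul. rewrite <- (ginv_involutive G (gmul (ginv x) y)) at 1.
    apply lenV. }
  intros x y. f_equal. apply Nat.le_antisymm; apply le.
- intros x y z. rewrite <- plus_INR. apply le_INR.
  eapply Nat.le_trans; [|apply lenM].
  now rewrite <- gmul_assoc, gmul_invr_cancel.
- intros g x y. now rewrite ginv_gmul, <- gmul_assoc, gmul_invl_cancel.
- intros r. destruct (INR_unbounded r) as [N hN].
  destruct (word_ball_finite G L w) with (n := N) as [l hl].
  { intros n. destruct (countable_set_sublevel_finite G L c hc n) as [l hl].
    exists l. intros x hx hxn. apply hl; trivial. unfold w in hxn; lia. }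
  exists l. intros y hy. rewrite ginv_gone, gmul_1l in hy.
  apply (hl (len y)); [|apply hlen].
  apply INR_le; lra.
Qed.

Lemma list_strict_upper_bound (T : Type) (phi : T -> R) (l : list T) :
  exists s, 0 < s /\ forall x, In x l -> phi x < s.
Proof.
induction l as [|a l [s [hs hl]]].
- exists 1. split; [lra|easy].
- exists (Rmax s (phi a + 1)).
  pose proof (Rmax_l s (phi a + 1)). pose proof (Rmax_r s (phi a + 1)).
  split; [lra|]. intros x [<-|hx]; [lra|]. specialize (hl x hx); lra.
Qed.

(** * Components and decompositions *)

Definition pseudometric {T : Type} (d : T -> T -> R) : Prop :=
  (forall x, d x x = 0) /\ (forall x y, d x y = d y x) /\
  (forall x y z, d x z <= d x y + d y z).

Lemma proper_pseudometric (G : Group) d :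
  proper_left_invariant_metric G d -> pseudometric d.
Proof.
intros (_ & h0 & hsym & htri & _). split; [|now split].
intros x; now apply h0.
Qed.

(** [chain d r A x] is the [r]-component of [x] in [A]. Steps are strictly below [r], so distinct
    components are at distance at least [r]. *)
Inductive chain {T : Type} (d : T -> T -> R) (r : R) (A : T -> Prop) (x : T)
  : T -> Prop :=
| chain_refl : A x -> chain d r A x x
| chain_snoc y z : chain d r A x y -> A z -> d y z < r -> chain d r A x z.

Lemma chain_end (T : Type) d r A (x y : T) : chain d r A x y -> A y.
Proof. now intros []. Qed.

Lemma chain_start (T : Type) d r A (x y : T) : chain d r A x y -> A x.
Proof. now induction 1. Qed.

Lemma chain_trans (T : Type) d r A (x y z : T) :
  chain d r A x y -> chain d r A y z -> chain d r A x z.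
Proof.
intros hxy; induction 1 as [|z t hz IH ht hzt]; [assumption|].
now apply chain_snoc with z.
Qed.

Lemma chain_sym (T : Type) d r A (x y : T) :
  pseudometric d -> chain d r A x y -> chain d r A y x.
Proof.
intros (_ & hsym & _); induction 1 as [|y z hy IH hz hyz].
- now constructor.
- apply chain_trans with y; [|exact IH].
  apply chain_snoc with z; [now constructor| |now rewrite hsym].
  exact (chain_end _ _ _ _ _ _ hy).
Qed.

Lemma chain_map (T T' : Type) (g : T -> T') d d' r r' A A' (x y : T) :
  (forall z, A z -> A' (g z)) ->
  (forall z t, d z t < r -> d' (g z) (g t) < r') ->
  chain d r A x y -> chain d' r' A' (g x) (g y).
Proof.
intros hA hd; induction 1 as [|y z hy IH hz hyz].
- now constructor; apply hA.
- apply chain_snoc with (g y); auto.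
Qed.

Definition comp_bdd {T : Type} (d : T -> T -> R) (r D : R) (A : T -> Prop) :=
  forall x y, chain d r A x y -> d x y <= D.

Lemma comp_bdd_sub (T : Type) (d : T -> T -> R) r D (A B : T -> Prop) :
  (forall x, A x -> B x) -> comp_bdd d r D B -> comp_bdd d r D A.
Proof.
intros hAB hB x y h. apply hB.
now apply (chain_map _ _ (fun z => z) d d r r A B).
Qed.

Lemma comp_bdd_le (T : Type) (d : T -> T -> R) r D D' (A : T -> Prop) :
  D <= D' -> comp_bdd d r D A -> comp_bdd d r D' A.
Proof. intros hD hA x y h. specialize (hA x y h); lra. Qed.

(** Choosing for each point of a chain a point of [A] within [s] gives a chain in [A] with steps
    below [r + 2 * s]. *)
Lemma comp_bdd_thicken (T : Type) (d : T -> T -> R) r s D (A : T -> Prop) :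
  pseudometric d -> comp_bdd d (r + 2 * s) D A ->
  comp_bdd d r (D + 2 * s) (fun x => exists z, A z /\ d x z < s).
Proof.
intros (h0 & hsym & htri) hA x y h.
destruct (chain_start _ _ _ _ _ _ h) as [a [ha hxa]].
assert (inv : exists b, chain d (r + 2 * s) A a b /\ d y b < s).
{ induction h as [|y z h [b [hab hyb]] [e [he hze]] hyz].
  - exists a. split; [now constructor|assumption].
  - exists e. split; [|assumption]. apply chain_snoc with b; trivial.
    pose proof (htri b y e); pose proof (htri y z e).
    rewrite (hsym b y) in *; lra. }
destruct inv as [b [hab hyb]].
pose proof (hA _ _ hab).
pose proof (htri x a y); pose proof (htri a b y).
rewrite (hsym b y) in *; lra.
Qed.

(** Finite union theorem: an excursion into [A] between two visits to [B] moves by less than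
    [2 * r + D], so the visits form a [rho]-chain in [B]. *)
Lemma comp_bdd_union (T : Type) (d : T -> T -> R) r rho D D' (A B : T -> Prop) :
  pseudometric d -> 0 < r -> 0 <= D -> 0 <= D' -> 2 * r + D <= rho ->
  comp_bdd d r D A -> comp_bdd d rho D' B ->
  comp_bdd d r (D' + 2 * D + 2 * r) (fun x => A x \/ B x).
Proof.
intros (h0 & hsym & htri) hr hD hD' hrho hA hB x y h.
(* [b] and [b'] are the first and last visits to [B]; a possible tail from [a] to [y] stays in
   [A]. *)
assert (inv : chain d r A x y \/ exists b b', d x b <= D + r /\
  chain d rho B b b' /\ (b' = y \/ exists a, d b' a < r /\ chain d r A a y)).
{ induction h as [[hx|hx]|y z h IH hz hyz].
  - left; now constructor.
  - right. exists x, x. rewrite h0. split; [lra|].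
    split; [now constructor|now left].
  - destruct IH as [IH|[b [b' [hxb [hbb' htail]]]]], hz as [hz|hz].
    + left. now apply chain_snoc with y.
    + right. exists z, z. pose proof (htri x y z). pose proof (hA _ _ IH).
      split; [lra|]. split; [now constructor|now left].
    + right. exists b, b'. repeat split; trivial. right.
      destruct htail as [<-|[a [hba hay]]].
      * exists z; split; [assumption|now constructor].
      * exists a; split; [assumption|now apply chain_snoc with y].
    + right. exists b, z. repeat split; [assumption| |now left].
      apply chain_snoc with b'; trivial.
      destruct htail as [<-|[a [hba hay]]]; [lra|].
      pose proof (hA _ _ hay). pose proof (htri b' a z).
      pose proof (htri a y z). lra. }
destruct inv as [inv|[b [b' [hxb [hbb' htail]]]]].
- pose proof (hA _ _ inv); lra.
- pose proof (hB _ _ hbb'). pose proof (htri x b y). pose proof (htri b b' y).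
  destruct htail as [<-|[a [hba hay]]]; [rewrite h0 in *; lra|].
  pose proof (hA _ _ hay). pose proof (htri b' a y). lra.
Qed.

(* [P] fails for at most [n] indices below [k]. *)
Definition misses_le (k n : nat) (P : nat -> Prop) : Prop :=
  forall l, NoDup l -> (forall i, In i l -> (i < k)%nat) ->
    (n < length l)%nat -> exists i, In i l /\ P i.

Lemma misses_le_impl k n (P Q : nat -> Prop) :
  (forall i, P i -> Q i) -> misses_le k n P -> misses_le k n Q.
Proof.
intros hPQ hP l hl hlk hn. destruct (hP l hl hlk hn) as [i [hi hPi]].
exists i; auto.
Qed.

Lemma classical_partition_seq (k : nat) (P : nat -> Prop) :
  exists l l', NoDup l /\ NoDup l' /\ (length l + length l' = k)%nat /\
    (forall i, In i l -> (i < k)%nat /\ P i) /\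
    (forall i, In i l' -> (i < k)%nat /\ ~ P i).
Proof.
induction k as [|k (l & l' & hl & hl' & hk & hP & hP')].
- exists nil, nil. repeat split; try constructor; now intros.
- assert (hS : forall i, In i l -> (i < S k)%nat /\ P i).
  { intros i hi. destruct (hP i hi); split; [lia|assumption]. }
  assert (hS' : forall i, In i l' -> (i < S k)%nat /\ ~ P i).
  { intros i hi. destruct (hP' i hi); split; [lia|assumption]. }
  destruct (classic (P k)) as [h|h].
  + exists (k :: l), l'. repeat apply conj; trivial.
    * constructor; [|assumption]. intros hin; destruct (hP k hin); lia.
    * simpl; lia.
    * intros i [<-|hi]; [split; [lia|assumption]|auto].
  + exists l, (k :: l'). repeat apply conj; trivial.
    * constructor; [|assumption]. intros hin; destruct (hP' k hin); lia.
    * simpl; lia.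
    * intros i [<-|hi]; [split; [lia|assumption]|auto].
Qed.

Lemma misses_le_common n m k (P Q : nat -> Prop) : (n + m < k)%nat ->
  misses_le k n P -> misses_le k m Q -> exists i, (i < k)%nat /\ P i /\ Q i.
Proof.
intros hk hP hQ.
destruct (classical_partition_seq k Q) as (l & l' & hl & hl' & hll & hin & hin').
(* If [Q] fails at no more than [m] indices, it holds at more than [n], and [P] cannot fail at all
   of those. *)
destruct (Nat.le_gt_cases (length l') m) as [hm|hm].
- destruct (hP l hl) as [i [hi hPi]]; [intros i hi; now apply hin|lia|].
  exists i. destruct (hin i hi). now repeat split.
- destruct (hQ l' hl') as [i [hi hQi]]; [intros i hi; now apply hin'|lia|].
  now destruct (hin' i hi).
Qed.

Definition decomposes {T : Type} (d : T -> T -> R) (A : T -> Prop) (n k : nat)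
    (r D : R) (U : nat -> T -> Prop) : Prop :=
  (forall i, (i < k)%nat -> comp_bdd d r D (U i)) /\
  (forall x, A x -> misses_le k n (fun i => U i x)).

Lemma misses_le_cover n (P : nat -> Prop) c :
  (c <= n)%nat -> P c -> misses_le (S n) n P.
Proof.
intros hc hP l hl hlk hn. exists c; split; [|assumption].
apply (NoDup_length_incl hl (l' := seq 0 (S n))).
- rewrite length_seq; lia.
- intros i hi. apply in_seq. specialize (hlk i hi); lia.
- apply in_seq; lia.
Qed.

Lemma asdim_le_metric_decomposes (T : Type) d (A : T -> Prop) n :
  asdim_le_metric d A n -> forall r, 0 < r ->
  exists D U, decomposes d A n (S n) r D U.
Proof.
intros hA r hr.
destruct (hA r hr) as (I & U & col & hcol & _ & hcov & [S hS] & hdis).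
exists S, (fun c x => exists i, col i = c /\ U i x). split.
- intros c _ x y h.
  assert (inv : exists i, col i = c /\ U i x /\ U i y).
  { induction h as [[i [hi hx]]|y z h [i [hi [hx hy]]] [j [hj hz]] hyz].
    - now exists i.
    - exists i. repeat split; trivial.
      destruct (classic (i = j)) as [->|hij]; [assumption|].
      assert (r <= d y z) by (apply (hdis i j hij); congruence). lra. }
  destruct inv as [i [_ [hx hy]]]. now apply (hS i).
- intros x hx. destruct (hcov x hx) as [i hi].
  apply misses_le_cover with (col i); [apply hcol|now exists i].
Qed.

(** The pieces are the [r]-components. Indexing them by the component as a predicate, rather than by
    a base point, gives each one a single index per colour. *)
Lemma asdim_le_metric_of_cover (T : Type) d (A : T -> Prop) n :
  pseudometric d ->
  (forall r, 0 < r -> exists D (X : nat -> T -> Prop),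
     (forall c, (c <= n)%nat -> comp_bdd d r D (X c)) /\
     (forall x, A x -> exists c, (c <= n)%nat /\ X c x)) ->
  asdim_le_metric d A n.
Proof.
intros hd hX r hr. destruct (hX r hr) as (D & X & hD & hcov).
exists (nat * (T -> Prop))%type.
exists (fun i x => (fst i <= n)%nat /\ A x /\ X (fst i) x /\
                   snd i = chain d r (X (fst i)) x).
(* The bound must hold for every index; those truncated here have empty pieces. *)
exists (fun i => Nat.min (fst i) n).
repeat apply conj.
- intros i; lia.
- now intros i x (_ & hx & _).
- intros x hx. destruct (hcov x hx) as [c [hc hcx]].
  now exists (c, chain d r (X c) x).
- exists D. intros [c P] x y (hc & _ & hx & eP) (_ & _ & hy & eP').
  simpl in *. apply (hD c hc). rewrite <- eP, eP'. now constructor.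
- intros [c P] [c' Q] hne hcol x y (hc & _ & hx & eP) (hc' & _ & hy & eQ).
  simpl in *. replace c' with c in * by lia.
  destruct (Rle_or_lt r (d x y)) as [h|h]; [assumption|].
  assert (hxy : chain d r (X c) x y).
  { apply chain_snoc with x; [now constructor|assumption|assumption]. }
  exfalso; apply hne. rewrite eP, eQ. f_equal.
  apply functional_extensionality; intros z.
  apply propositional_extensionality; split; intros hz.
  + apply chain_trans with x; [now apply chain_sym|assumption].
  + now apply chain_trans with y.
Qed.

(* Kolmogorov's trick: the new class consists of the points missing exactly [n]
   of the thickened old classes.  The set of missed indices is constant along a
   chain of such points, so the chain stays in a single old class. *)
Lemma decomposes_succ (T : Type) (d : T -> T -> R) A n k r D U :
  pseudometric d -> (n < k)%nat -> 0 < r ->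
  decomposes d A n k (3 * r) D U ->
  exists V, decomposes d A n (S k) r (D + 2 * r) V.
Proof.
intros hd hnk hr [hU hA].
pose proof hd as (h0 & hsym & htri).
set (W := fun i x => exists z, U i z /\ d x z < r).
exists (fun i x => (i < k)%nat /\ W i x \/
  i = k /\ A x /\ exists l, NoDup l /\ (forall i, In i l -> (i < k)%nat) /\
    (n <= length l)%nat /\ forall i, In i l -> ~ W i x).
assert (UW : forall i x, U i x -> W i x).
{ intros i x hx. exists x. now rewrite h0. }
split.
- intros i hi. destruct (Nat.eq_dec i k) as [->|hik].
  + intros x y h.
    destruct (chain_start _ _ _ _ _ _ h)
      as [[hk _]|(_ & hx & l & hl & hlk & hn & hlW)]; [lia|].
    assert (len_le : forall l' z, A z -> NoDup l' ->
      (forall i, In i l' -> (i < k)%nat) -> (forall i, In i l' -> ~ U i z) ->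
      (length l' <= n)%nat).
    { intros l' z hz hl' hlk' hlU. apply Nat.nlt_ge; intros hlt.
      destruct (hA z hz l' hl' hlk' hlt) as [j [hj hUj]].
      now apply (hlU j). }
    (* As [n < k], some [i] lies outside [l]; a point of [A] missing [W j] for all [j] in [l]
       already misses [n] classes, so it lies in [U i]. *)
    destruct (classic (exists i, (i < k)%nat /\ ~ In i l))
      as [[i [hik hil]]|hall].
    2: { assert (k <= n)%nat; [|lia].
      rewrite <- (length_seq k 0).
      apply (len_le _ x hx); [apply seq_NoDup| |].
      - intros j hj; apply in_seq in hj; lia.
      - intros j hj hj'. apply (hlW j); [|now apply UW].
        apply NNPP; intros hjl. apply hall; exists j.
        apply in_seq in hj; split; [lia|assumption]. }
    assert (mem : forall z, A z -> (forall j, In j l -> ~ W j z) -> U i z).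
    { intros z hz hlz. apply NNPP; intros hiz.
      assert (length (i :: l) <= n)%nat; [|simpl in *; lia].
      apply (len_le _ z hz); [now constructor| |].
      - intros j [<-|hj]; auto.
      - intros j [<-|hj]; [assumption|intros hj'].
        apply (hlz j); auto. }
    assert (inv : chain d (3 * r) (U i) x y /\ forall j, In j l -> ~ W j y).
    { induction h as [hx'|y z h [IH hy] hz hyz].
      - split; [constructor; now apply mem|assumption].
      - destruct hz as [[hz _]|(_ & hz & l' & hl' & hlk' & hn' & hlW')]; [lia|].
        (* A step shorter than [r] from [y] to [z] turns [~ W j y] into [~ U j z]; were [j] outside
           [l'], the point [z] would miss [n + 1] classes. *)
        assert (hll' : incl l l').
        { intros j hj. apply NNPP; intros hjl.
          assert (length (j :: l') <= n)%nat; [|simpl in *; lia].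
          apply (len_le _ z hz); [now constructor| |].
          - intros p [<-|hp]; auto.
          - intros p [<-|hp].
            + intros hjz. apply (hy j hj). now exists z.
            + intros hp'. apply (hlW' p); auto. }
        assert (hlz : forall j, In j l -> ~ W j z) by auto.
        split; [|exact hlz].
        apply chain_snoc with y; [assumption|now apply mem|lra]. }
    destruct inv as [inv _].
    pose proof (hU i hik _ _ inv). lra.
  + apply comp_bdd_sub with (W i).
    * intros x [[_ h]|[h _]]; [assumption|lia].
    * apply comp_bdd_thicken; [assumption|].
      replace (r + 2 * r) with (3 * r) by lra. apply hU; lia.
- intros x hx l hl hlk hn.
  apply NNPP; intros hno.
  assert (hlW : forall i, In i l -> (i < k)%nat -> ~ W i x).
  { intros i hi hik hW. apply hno; exists i. split; [assumption|]. now left. }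
  destruct (in_dec Nat.eq_dec k l) as [hin|hin].
  (* Without [k], at least [n] old indices remain, all missed by [x], which puts [x] in the new
     class. *)
  + apply hno; exists k; split; [assumption|]. right.
    split; [reflexivity|]. split; [assumption|].
    destruct (in_split k l hin) as (l1 & l2 & ->).
    destruct (NoDup_remove _ _ _ hl) as [hl' hkl'].
    assert (hlk' : forall i, In i (l1 ++ l2) ->
        In i (l1 ++ k :: l2) /\ (i < k)%nat).
    { intros i hi.
      assert (hi' : In i (l1 ++ k :: l2)).
      { apply in_app_iff in hi; apply in_app_iff; simpl; tauto. }
      assert (i <> k) by now intros ->.
      specialize (hlk i hi'). split; [assumption|lia]. }
    exists (l1 ++ l2). repeat apply conj; trivial.
    * intros i hi; now apply hlk'.
    * rewrite length_app in *; simpl in hn; lia.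
    * intros i hi; now apply hlW; apply hlk'.
  + assert (hlk' : forall i, In i l -> (i < k)%nat).
    { intros i hi. assert (i <> k) by now intros ->.
      specialize (hlk i hi); lia. }
    destruct (hA x hx l hl hlk' hn) as [i [hi hUi]].
    apply (hlW i); auto.
Qed.

Lemma asdim_le_metric_decomposes_ge (T : Type) (d : T -> T -> R) A n k :
  pseudometric d -> asdim_le_metric d A n -> (n < k)%nat ->
  forall r, 0 < r -> exists D U, decomposes d A n k r D U.
Proof.
intros hd hA hk; induction hk as [|k hk IH]; intros r hr.
- now apply asdim_le_metric_decomposes.
- destruct (IH (3 * r)) as [D [U hU]]; [lra|].
  destruct (decomposes_succ T d A n k r D U hd hk hr hU) as [V hV].
  now exists (D + 2 * r), V.
Qed.

(** * Quasimorphisms *)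

Section Quasimorphism.
Context (G H : Group) (f : G -> H).
Context (hq : quasimorphism f) (hs : symmetric_map f).

Lemma quasimorphism_gmul (x y : G) :
  exists z, defect f z /\ f (gmul x y) = gmul (f x) (gmul (f y) z).
Proof.
exists (gmul (ginv (f y)) (gmul (ginv (f x)) (f (gmul x y)))).
split; [now exists x, y|].
now rewrite !gmul_invr_cancel.
Qed.

(** [f y] is [f x] times [f (x^-1 y) z], where [x^-1 y] lies in a finite ball and [z] in the finite
    defect set. *)
Lemma quasimorphism_coarse d e :
  proper_left_invariant_metric G d -> proper_left_invariant_metric H e ->
  forall r, exists s, 0 < s /\ forall x y, d x y < r -> e (f x) (f y) < s.
Proof.
intros (_ & _ & _ & _ & dl & dp) (_ & _ & _ & _ & el & _) r.
destruct (dp r) as [K hK]. destruct hq as [L hL].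
destruct (list_strict_upper_bound _
  (fun p : G * H => e gone (gmul (f (fst p)) (snd p))) (list_prod K L))
  as [s [hs0 hsl]].
exists s; split; [assumption|]. intros x y hxy.
destruct (quasimorphism_gmul x (gmul (ginv x) y)) as [z [hz hf]].
rewrite gmul_invr_cancel in hf. rewrite hf.
rewrite <- (gmul_1r H (f x)) at 1. rewrite el.
apply (hsl (gmul (ginv x) y, z)). apply in_prod; [|now apply hL].
apply hK. rewrite <- (gmul_Vl G x), dl. lra.
Qed.

(** If [f x = f g], symmetry makes [f (x g^-1)] equal to the defect of the pair [x], [g^-1]. The
    distance from [x] to [x g^-1] depends on [g] only, and one [g] per element of [K] suffices. *)
Lemma finite_preimage_near_defect d (K : list H) :
  proper_left_invariant_metric G d ->
  exists s, 0 < s /\ forall x, In (f x) K ->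
    exists z, defect f (f z) /\ d x z < s.
Proof.
intros (_ & _ & _ & _ & dl & _).
induction K as [|h K [s [hs0 hK]]].
- exists 1. split; [lra|easy].
- destruct (classic (exists g, f g = h)) as [[g hg]|hno].
  + exists (Rmax s (d gone (ginv g) + 1)).
    pose proof (Rmax_l s (d gone (ginv g) + 1)).
    pose proof (Rmax_r s (d gone (ginv g) + 1)).
    split; [lra|]. intros x [hx|hx].
    * exists (gmul x (ginv g)). split.
      -- exists x, (ginv g).
         now rewrite hs, ginv_involutive, hg, hx, gmul_invr_cancel.
      -- rewrite <- (gmul_1r G x) at 1. rewrite dl. lra.
    * destruct (hK x hx) as [z [hz hxz]]. exists z. split; [assumption|lra].
  + exists s. split; [assumption|]. intros x [hx|hx]; [|now apply hK].
    exfalso; apply hno; now exists x.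
Qed.

(** Translating by [x0^-1], with [x0] over [B], takes the preimage of [B] to points with values in
    the finite set [KL], hence within [s] of the preimage of the defect set. One decomposition of
    the latter, thickened and translated back, serves every [B]. *)
Lemma fibres_decompose d e m k :
  proper_left_invariant_metric G d -> proper_left_invariant_metric H e ->
  asdim_le_metric d (fun z => defect f (f z)) m -> (m < k)%nat ->
  forall r R0, 0 < r -> exists D, forall B : H -> Prop,
    (forall u v, B u -> B v -> e u v <= R0) ->
    exists U, decomposes d (fun x => B (f x)) m k r D U.
Proof.
intros hd he hm hk r R0 hr.
pose proof hd as (_ & _ & _ & _ & dl & _).
pose proof he as (_ & _ & _ & _ & el & ep).
destruct (ep R0) as [K hK]. destruct hq as [L hL].
set (KL := map (fun p => gmul (fst p) (snd p)) (list_prod K L)).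
destruct (finite_preimage_near_defect d KL hd) as [s [hs0 hnear]].
destruct (asdim_le_metric_decomposes_ge _ _ _ _ _
  (proper_pseudometric G d hd) hm hk (r + 2 * s)) as [D [U [hU hcov]]]; [lra|].
exists (D + 2 * s). intros B hB.
destruct (classic (exists x0, B (f x0))) as [[x0 hx0]|hno].
- exists (fun i x => exists z, U i z /\ d (gmul (ginv x0) x) z < s). split.
  + intros i hi x y h. rewrite <- (dl (ginv x0)).
    apply (comp_bdd_thicken _ d r s D (U i) (proper_pseudometric G d hd)
             (hU i hi)).
    revert h; apply chain_map; [trivial|]. intros z t; now rewrite dl.
  + intros x hx.
    destruct (quasimorphism_gmul (ginv x0) x) as [w [hw hf]].
    destruct (hnear (gmul (ginv x0) x)) as [z [hz hxz]].
    { rewrite hf, hs, gmul_assoc.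
      apply (in_map (fun p : H * H => gmul (fst p) (snd p)) _
        (gmul (ginv (f x0)) (f x), w)).
      apply in_prod; [|now apply hL].
      apply hK. rewrite <- (gmul_Vl H (f x0)), el. now apply hB. }
    apply misses_le_impl with (2 := hcov z hz).
    intros i hi; now exists z.
- exists (fun _ _ => False). split.
  + intros i hi x y h. now apply chain_start in h.
  + intros x hx. exfalso; apply hno; now exists x.
Qed.

End Quasimorphism.

(** * The Hurewicz argument *)

(* Colours are added one at a time, each decomposed at a scale exceeding the
   bound [D] obtained for the previous ones. *)
Lemma fibrewise_decomposition (X Y J : Type) (d : X -> X -> R) (e : Y -> Y -> R)
  (f : X -> Y) (T : J -> Y -> Prop) (col : J -> nat) m k R0 :
  pseudometric d ->
  (forall r, 0 < r -> exists D, forall j,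
     exists U, decomposes d (fun x => T j (f x)) m k r D U) ->
  (forall i j, i <> j -> col i = col j ->
     forall u v, T i u -> T j v -> R0 < e u v) ->
  forall c r, 0 < r -> exists D (E : nat -> X -> Prop), 0 <= D /\
    (forall i (B : Y -> Prop), (i < k)%nat ->
       (forall u v, B u -> B v -> e u v <= R0) ->
       comp_bdd d r D (fun x => E i x /\ B (f x))) /\
    (forall j x, (col j < c)%nat -> T j (f x) ->
       misses_le k m (fun i => E i x)).
Proof.
intros hd hT hdis c r hr; induction c as [|c (D & E & hD & hE & hcov)].
- exists 0, (fun _ _ => False). repeat split; [lra| |lia].
  intros i B hi hB x y h. now apply chain_start in h.
- destruct (hT (2 * r + D)) as [D' hD']; [lra|].
  apply functional_choice in hD'. destruct hD' as [U hU].
  pose proof (Rmax_l 0 D'). pose proof (Rmax_r 0 D').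
  exists (Rmax 0 D' + 2 * D + 2 * r).
  exists (fun i x => E i x \/ exists j, col j = c /\ T j (f x) /\ U j i x).
  repeat apply conj; [lra| |].
  + intros i B hi hB.
    apply comp_bdd_sub with (fun x => (E i x /\ B (f x)) \/
      exists j, col j = c /\ T j (f x) /\ U j i x /\ B (f x)).
    { intros x [[hx|[j hx]] hb]; [now left|right; exists j; tauto]. }
    apply comp_bdd_union with (2 * r + D); trivial; try lra.
    * now apply hE.
    * apply comp_bdd_le with D'; [lra|]. intros x y h.
      (* The whole chain lies over a single [T j]: distinct ones of colour [c] are more than [R0]
         apart, while [B] has diameter at most [R0]. *)
      destruct (chain_start _ _ _ _ _ _ h) as [j (hj & hjx & _ & hbx)].
      apply (proj1 (hU j) i hi). revert h.
      apply (chain_map _ _ (fun z => z)); [|trivial].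
      intros z [j' (hj' & hjz & hz & hbz)].
      destruct (classic (j = j')) as [->|hne]; [assumption|].
      pose proof (hdis j j' hne ltac:(congruence) _ _ hjx hjz).
      pose proof (hB _ _ hbx hbz). lra.
  + intros j x hj hjx.
    destruct (Nat.eq_dec (col j) c) as [hjc|hjc].
    * apply misses_le_impl with (2 := proj2 (hU j) x hjx).
      intros i hi; right; now exists j.
    * apply misses_le_impl with (2 := hcov j x ltac:(lia) hjx).
      intros i hi; now left.
Qed.

Theorem theorem4p6 (G H : Group) (Xi : G -> Prop) (Lam : H -> Prop) (f : G -> H)
  (hXi : approx_group G Xi) (hXic : countable_set Xi)
  (hLam : approx_group H Lam) (hLamc : countable_set Lam)
  (hfXi : forall x, Xi x -> Lam (f x))
  (hq : quasimorphism f) (hs : symmetric_map f) (hu : unital_map f) :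
  forall n m : nat,
    asdim_le H Lam n ->
    asdim_le G (fun z => defect f (f z)) m ->
    asdim_le G Xi (n + m).
Proof.
intros n m hn hm d hd.
destruct hLam as [[hLinv _] hLgen].
(* [asdim_le] quantifies over all metrics, so the bound on [Lam] yields something only once a metric
   on [H] is exhibited. *)
destruct (proper_left_invariant_metric_exists H Lam hLinv hLamc hLgen) as [e he].
specialize (hn e he); specialize (hm d hd).
pose proof (proper_pseudometric G d hd) as hdp.
pose proof (proper_pseudometric H e he) as hep.
apply asdim_le_metric_of_cover; [assumption|]. intros r hr.
destruct (quasimorphism_coarse G H f hq d e hd he r) as [s [hs0 hrs]].
set (k := S (n + m)).
destruct (asdim_le_metric_decomposes_ge _ e Lam n k hep hn ltac:(lia) s hs0)
  as [R0 [Y [hY hYcov]]].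
(* The maximum keeps the scale [R1 + 1] positive; the added one makes the separation strict. *)
set (R1 := Rmax 0 R0).
pose proof (Rmax_l 0 R0 : 0 <= R1). pose proof (Rmax_r 0 R0 : R0 <= R1).
destruct (hn (R1 + 1)) as (J & T & col & hcol & _ & hTcov & [S0 hS0] & hdis);
  [lra|].
destruct (fibrewise_decomposition G H J d e f T col m k R1 hdp) with
  (c := S n) (r := r) as (D & E & _ & hE & hEcov); trivial.
{ intros r' hr'.
  destruct (fibres_decompose G H f hq hs d e m k hd he hm ltac:(lia) r' S0 hr')
    as [D hD].
  exists D. intros j. apply hD. intros u v; apply hS0. }
{ intros i j hij hc u v hu' hv. specialize (hdis i j hij hc u v hu' hv). lra. }
exists D, (fun i x => E i x /\ Y i (f x)). split.
- intros i hi x y h.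
  (* [f] maps [r]-steps to [s]-steps, so the chain from [x] stays over the [s]-component of [f x] in
     [Y i], of diameter at most [R0]. *)
  apply (hE i (fun u => chain e s (Y i) (f x) u)); [lia| |].
  + intros u v hu' hv.
    assert (e u v <= R0); [|lra]. apply (hY i); [lia|].
    apply chain_trans with (f x); [now apply chain_sym|assumption].
  + assert (hx := chain_start _ _ _ _ _ _ h).
    induction h as [_|y z h IH hz hyz].
    * repeat constructor; apply hx.
    * apply chain_snoc with y; trivial. split; [apply hz|].
      apply chain_snoc with (f y); [|apply hz|now apply hrs].
      apply (chain_end _ _ _ _ _ _ IH).
- intros x hx. destruct (hTcov (f x) (hfXi x hx)) as [j hj].
  destruct (misses_le_common n m k (fun i => Y i (f x)) (fun i => E i x))
    as (i & hi & hYi & hEi).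
  + lia.
  + now apply hYcov, hfXi.
  + apply (hEcov j); [|assumption]. specialize (hcol j); lia.
  + exists i. split; [lia|now split].
Qed.
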